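(* Let $n\ge2$ and let $X=(u,\gamma+s)$, $Y=(v,\delta+t)$ belong to $V_n^{\mathbb C}$, where $u,v,s,t\in V_{n-1}^{\mathbb C}$ and $\gamma,\delta\in\mathbb C$. Define $$Z_+:=\mathsf C_{n-1}(u+\iota s,v+\iota t),\qquad Z_-:=\mathsf C_{n-1}(u-\iota s,v-\iota t),$$ and put $\lambda:=\langle s,v\rangle_{\mathrm{bil}}-\langle t,u\rangle_{\mathrm{bil}}$. Then $$\mathsf C_n(X,Y)=\Bigl(\frac{Z_++Z_-}{2}+\gamma t-\delta s,\;\;\lambda+\delta u-\gamma v+\frac{\iota}{2}(Z_+-Z_-)\Bigr).$$ Consequently, one evaluation of $\mathsf C_n$ requires only two evaluations of $\mathsf C_{n-1}$ together with $O(2^n)$ complex arithmetic operations.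
   Context: **Cayley--Dickson tower.** $A_0:=\mathbb R$ with $\bar r=r$. Recursively $A_n:=A_{n-1}\oplus A_{n-1}$ with $$\overline{(a,b)}=(\bar a,-b),\qquad (a,b)(c,d)=\bigl(ac-\bar d\,b,\;da+b\bar c\bigr).$$ The standard (recursive, concatenated) basis identifies $A_n$ with $\mathbb R^{2^n}$. Scalars are identified with multiples of the unit. Put $V_n:=\{x\in A_n:\bar x=-x\}$, and for $u,v\in V_n$ define $u\times_n v:=\frac12(uv-vu)$, which lies in $V_n$. **Scalar extension.** $A_n^{\mathbb C}:=A_n\otimes_{\mathbb R}\mathbb C$, $V_n^{\mathbb C}:=V_n\otimes_{\mathbb R}\mathbb C$, with $\iota$ the central coefficient satisfying $\iota^2=-1$, so $\mathbb C=\mathbb R(\iota)$. The Cayley--Dickson involution is extended $\mathbb C$-linearly (in particular it fixes $\iota$). The coefficient pairing is extended bilinearly: $\langle z,w\rangle_{\mathrm{bil}}:=\sum_j z_jw_j$, conjugating neither argument. $\mathsf C_n:V_n^{\mathbb C}\times V_n^{\mathbb C}\to V_n^{\mathbb C}$ denotes the complex-bilinear extension of $\times_n$. For $n\ge2$, every element of $V_n^{\mathbb C}\subset A_{n-1}^{\mathbb C}\oplus A_{n-1}^{\mathbb C}$ is uniquely of the form $(u,\gamma+s)$ with $u,s\in V_{n-1}^{\mathbb C}$ and $\gamma\in\mathbb C$. *)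

(* Defs.v *)
From mathcomp Require Import all_boot all_order all_algebra.
From mathcomp Require Import reals ring.
From mathcomp Require Export complex.

Set Implicit Arguments.
Unset Strict Implicit.
Unset Printing Implicit Defensive.

Import Order.TTheory GRing.Theory Num.Theory.
Local Open Scope ring_scope.
Local Open Scope complex_scope.

(** * The Cayley-Dickson tower

    [A_n] is the space of row vectors of length [cdim n] ([= 2 ^ n]).  The
    length is computed by doubling, so that [A_n.+1] splits definitionally as
    [A_n (+) A_n]: the pair [(a, b)] is [row_mx a b], and its standard basis is
    the concatenation of the bases of the two factors. *)

Fixpoint cdim (n : nat) : nat :=
  if n is m.+1 then (cdim m + cdim m)%N else 1%N.

Lemma cdimE n : cdim n = (2 ^ n)%N.
Proof. by elim: n => // n IHn; rewrite expnS mul2n -addnn /= IHn. Qed.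

Notation cdalg K n := 'rV[K]_(cdim n).

Fixpoint cd_conj (R : realType) (n : nat) : cdalg R n -> cdalg R n :=
  match n return cdalg R n -> cdalg R n with
  | 0 => fun x => x
  | m.+1 => fun x : cdalg R m.+1 =>
      row_mx (cd_conj (lsubmx x)) (- rsubmx x)
  end.

Fixpoint cd_mul (R : realType) (n : nat) : cdalg R n -> cdalg R n -> cdalg R n :=
  match n return cdalg R n -> cdalg R n -> cdalg R n with
  | 0 => fun x y => const_mx (x 0 0 * y 0 0)
  | m.+1 => fun x y : cdalg R m.+1 =>
      let a := lsubmx x in let b := rsubmx x in
      let c := lsubmx y in let d := rsubmx y in
      row_mx (cd_mul a c - cd_mul (cd_conj d) b)
             (cd_mul d a + cd_mul b (cd_conj c))
  end.

Fixpoint cd_one (R : realType) (n : nat) : cdalg R n :=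
  match n return cdalg R n with
  | 0 => const_mx 1
  | m.+1 => row_mx (cd_one R m) 0
  end.

(** [V_n]. *)
Definition cd_imag (R : realType) (n : nat) (x : cdalg R n) : Prop :=
  cd_conj x = - x.

(** [x \times_n y]; this is used for [x, y] in [V_n] only. *)
Definition cd_cross (R : realType) (n : nat) (x y : cdalg R n) : cdalg R n :=
  2^-1 *: (cd_mul x y - cd_mul y x).

Lemma cd_conjP (R : realType) n (a : R) (x y : cdalg R n) :
  cd_conj (a *: x + y) = a *: cd_conj x + cd_conj y.
Proof.
elim: n x y => //= n IHn x y; rewrite !linearP /= IHn.
by rewrite scale_row_mx add_row_mx.
Qed.

Lemma cd_mulP (R : realType) n (a : R) (x y z : cdalg R n) :
  cd_mul (a *: x + y) z = a *: cd_mul x z + cd_mul y z /\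
  cd_mul z (a *: x + y) = a *: cd_mul z x + cd_mul z y.
Proof.
elim: n x y z => [|n IHn] x y z.
  split; apply/matrixP => i j; rewrite !mxE; first by rewrite mulrDl mulrA.
  by rewrite mulrDr mulrCA.
have l u v w := (IHn u v w).1; have r u v w := (IHn u v w).2.
split; rewrite /= !linearP /= ?cd_conjP !(l, r) scale_row_mx add_row_mx;
  by congr row_mx; rewrite ?scalerBr ?scalerDr ?opprD addrACA.
Qed.

Lemma cd_crossPl (R : realType) n (a : R) (x y z : cdalg R n) :
  cd_cross (a *: x + y) z = a *: cd_cross x z + cd_cross y z.
Proof.
rewrite /cd_cross (cd_mulP a x y z).1 (cd_mulP a x y z).2.
by rewrite opprD addrACA -scalerBr scalerDr !scalerA mulrC.
Qed.

Lemma cd_crossC (R : realType) n (x y : cdalg R n) :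
  cd_cross x y = - cd_cross y x.
Proof. by rewrite /cd_cross -scalerN opprB. Qed.

(** * Extension of scalars

    [A_n (x) C] is the space of row vectors over [R[i]].  Every element is
    uniquely [x + iotaC *: y] with [x, y] in [A_n], its coordinatewise real and
    imaginary parts. *)

Definition iotaC (R : realType) : R[i] := 0 +i* 1.

Definition mxRe (R : realType) m (z : 'rV[R[i]]_m) : 'rV[R]_m :=
  map_mx (@complex.Re R) z.
Definition mxIm (R : realType) m (z : 'rV[R[i]]_m) : 'rV[R]_m :=
  map_mx (@complex.Im R) z.
Definition mxC (R : realType) m (x : 'rV[R]_m) : 'rV[R[i]]_m :=
  map_mx (real_complex R) x.

(** [V_n (x) C = V_n (+) iota V_n]. *)
Definition cdC_imag (R : realType) (n : nat) (z : cdalg R[i] n) : Prop :=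
  cd_imag (mxRe z) /\ cd_imag (mxIm z).

(** The complex scalar [a], as a multiple of the unit of [A_n (x) C]. *)
Definition cdC_scalar (R : realType) (n : nat) (a : R[i]) : cdalg R[i] n :=
  a *: mxC (cd_one R n).

(** The bilinear coefficient pairing; no argument is conjugated. *)
Definition bil (R : realType) m (z w : 'rV[R[i]]_m) : R[i] :=
  \sum_j z 0 j * w 0 j.

(** [\mathsf C_n]: the product [\times_n] extended by
    [(x + iota y, x' + iota y') |->
       (x \times_n x' - y \times_n y') + iota (x \times_n y' + y \times_n x')];
    by [cdC_cross_real], [cdC_crossPl] and [cdC_crossPr] below it is the
    complex-bilinear extension of [\times_n]. *)
Definition cdC_cross (R : realType) (n : nat) (z w : cdalg R[i] n) :
    cdalg R[i] n :=
  mxC (cd_cross (mxRe z) (mxRe w) - cd_cross (mxIm z) (mxIm w))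
  + iotaC R *: mxC (cd_cross (mxRe z) (mxIm w) + cd_cross (mxIm z) (mxRe w)).

Lemma cdC_cross_real (R : realType) n (x y : cdalg R n) :
  cdC_cross (mxC x) (mxC y) = mxC (cd_cross x y).
Proof.
have Re0 (z : cdalg R n) : mxRe (mxC z) = z by apply/matrixP=> i j; rewrite !mxE.
have Im0 (z : cdalg R n) : mxIm (mxC z) = 0 by apply/matrixP=> i j; rewrite !mxE.
have c0 (z : cdalg R n) : cd_cross 0 z = 0.
  by have := cd_crossPl (-1) 0 0 z; rewrite !scaleN1r !addNr.
rewrite /cdC_cross !Re0 !Im0 !c0 (cd_crossC x 0) c0 !oppr0 !addr0.
by rewrite /mxC raddf0 scaler0 addr0.
Qed.

Lemma cdC_crossC (R : realType) n (z w : cdalg R[i] n) :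
  cdC_cross z w = - cdC_cross w z.
Proof.
rewrite /cdC_cross (cd_crossC (mxRe z) (mxRe w)) (cd_crossC (mxIm z) (mxIm w)).
rewrite (cd_crossC (mxRe z) (mxIm w)) (cd_crossC (mxIm z) (mxRe w)).
apply/matrixP=> i j; rewrite !mxE /=; apply/eqP; rewrite eq_complex /=.
by apply/andP; split; apply/eqP; ring.
Qed.

Lemma cdC_crossPl (R : realType) n (a : R[i]) (x y z : cdalg R[i] n) :
  cdC_cross (a *: x + y) z = a *: cdC_cross x z + cdC_cross y z.
Proof.
case: a => a b.
have eRe : mxRe ((a +i* b) *: x + y) = a *: mxRe x + ((- b) *: mxIm x + mxRe y).
  apply/matrixP=> i j; rewrite !mxE; case: (x i j) (y i j) => [p q] [p' q'] /=.
  by rewrite mulNr addrA.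
have eIm : mxIm ((a +i* b) *: x + y) = a *: mxIm x + (b *: mxRe x + mxIm y).
  apply/matrixP=> i j; rewrite !mxE; case: (x i j) (y i j) => [p q] [p' q'] /=.
  by rewrite addrA.
rewrite /cdC_cross eRe eIm !cd_crossPl.
apply/matrixP=> i j; rewrite !mxE /=; apply/eqP; rewrite eq_complex /=.
by apply/andP; split; apply/eqP; ring.
Qed.

Lemma cdC_crossPr (R : realType) n (a : R[i]) (x y z : cdalg R[i] n) :
  cdC_cross z (a *: x + y) = a *: cdC_cross z x + cdC_cross z y.
Proof.
by rewrite cdC_crossC cdC_crossPl opprD -scalerN -!(cdC_crossC z).
Qed.

(** * Straight-line programs with an oracle

    A program acts on registers indexed by [nat] and holding elements of [K].
    It has no branching, so its cost does not depend on the data.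
    [ICall d a b] applies the oracle to the two blocks of [m] registers that
    start at [a] and [b], and writes the result in the block starting at [d].
    Loading a constant counts as an arithmetic operation. *)

Inductive instr (K : Type) : Type :=
| IConst (d : nat) (c : K)
| IAdd (d a b : nat)
| ISub (d a b : nat)
| IMul (d a b : nat)
| ICall (d a b : nat).

Definition is_call (K : Type) (i : instr K) : bool :=
  if i is ICall _ _ _ then true else false.

Definition calls (K : Type) (p : seq (instr K)) : nat := count (@is_call K) p.
Definition arith_ops (K : Type) (p : seq (instr K)) : nat :=
  count (fun i => ~~ is_call i) p.

Section Execution.
Variables (K : pzRingType) (m : nat).
Variable oracle : 'rV[K]_m -> 'rV[K]_m -> 'rV[K]_m.

Definition read_block k (mem : nat -> K) (a : nat) : 'rV[K]_k :=
  \row_(j < k) mem (a + j)%N.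

Definition write_block k (mem : nat -> K) (d : nat) (v : 'rV[K]_k) : nat -> K :=
  fun r => if (d <= r)%N then
             if insub (r - d)%N is Some j then v 0 j else mem r
           else mem r.

Definition write (mem : nat -> K) (d : nat) (c : K) : nat -> K :=
  fun r => if r == d then c else mem r.

Definition step (mem : nat -> K) (i : instr K) : nat -> K :=
  match i with
  | IConst d c => write mem d c
  | IAdd d a b => write mem d (mem a + mem b)
  | ISub d a b => write mem d (mem a - mem b)
  | IMul d a b => write mem d (mem a * mem b)
  | ICall d a b =>
      write_block mem d (oracle (read_block m mem a) (read_block m mem b))
  end.

Definition run (p : seq (instr K)) (mem : nat -> K) : nat -> K :=
  foldl step mem p.

(** Registers [0, ..., 2k - 1] hold the inputs, the others hold [0];
    the result is read in the block starting at [out]. *)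
Definition run2 (p : seq (instr K)) (out k : nat) (x y : 'rV[K]_k) : 'rV[K]_k :=
  read_block k (run p (write_block (fun=> 0) 0 (row_mx x y))) out.

End Execution.

(** [p] evaluates [\mathsf C_n.+1] on [V_n.+1 (x) C], given any oracle which is
    correct on [V_n (x) C].  Nothing is assumed of the oracle elsewhere, so
    only evaluations of [\mathsf C_n] on its domain are of any use to [p]. *)
Definition evaluates_cross (R : realType) (n : nat)
    (p : seq (instr R[i])) (out : nat) : Prop :=
  forall f : cdalg R[i] n -> cdalg R[i] n -> cdalg R[i] n,
    (forall z w, cdC_imag z -> cdC_imag w -> f z w = cdC_cross z w) ->
  forall X Y : cdalg R[i] n.+1, cdC_imag X -> cdC_imag Y ->
    run2 f p out X Y = cdC_cross X Y.

(* Main.v *)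
Require Import Defs.
From mathcomp Require Import all_boot all_order all_algebra.
From mathcomp Require Import reals complex.
From mathcomp Require Import ring.
Import GRing.Theory Num.Theory.
Local Open Scope ring_scope.
Local Open Scope complex_scope.

(** Multiplying out [(u, g + s)(v, d + t)] and the opposite product, half of the
    commutator has the components
      [u x v - s x t + g t - d s]   and   [d u - g v + (t u - s v)].
    The products [t u] and [s v] are not commutators, but in every
    Cayley-Dickson algebra the symmetric part of a product of two imaginary
    elements is the scalar [- <x, y>] ([cd_mul_polar], [cd_mul_imag]), so that
    [t u - s v = (<s, v> - <t, u>) + t x u - s x v] ([cd_cross_row]; extended to
    complex scalars in [cdC_cross_row]).  Four cross products of the smaller
    algebra remain, in [u x v - s x t] and [- (u x t + s x v)].  They come,
    up to sign, from a complex multiplication in which [iota] acts on the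
    coefficients: [Z+ = (u + iota s) x (v + iota t)] and its formal conjugate
    [Z- = (u - iota s) x (v - iota t)] have
    half sum [u x v - s x t] and half difference [iota (u x t + s x v)]
    ([cdC_cross_polar]), whence two products suffice
    ([cdC_cross_two_calls]).

    For the cost, the memory is cut into blocks of [2 ^ n] registers.
    Programs are first written for a machine whose registers hold whole blocks,
    and each of its instructions other than a call is compiled to a loop of
    [2 ^ n] scalar instructions ([compile_prog_correct], [arith_ops_compile]).
    The formula is a vector program of 32 instructions, two of them calls
    ([cross_prog_correct]). *)

Set Implicit Arguments.
Unset Strict Implicit.

(** * Real Cayley-Dickson algebras *)

Lemma cdim_gt0 n : (0 < cdim n)%N.
Proof. by rewrite cdimE expn_gt0. Qed.

Definition cd0 n : 'I_(cdim n) := Ordinal (cdim_gt0 n).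

Section RealTower.
Variable R : realType.

Definition dot m (x y : 'rV[R]_m) : R := \sum_j x 0 j * y 0 j.

Lemma dot_row m1 m2 (a c : 'rV[R]_m1) (b d : 'rV[R]_m2) :
  dot (row_mx a b) (row_mx c d) = dot a c + dot b d.
Proof.
rewrite /dot big_split_ord /=.
by congr (_ + _); apply: eq_bigr => i _; rewrite ?row_mxEl ?row_mxEr.
Qed.

Lemma cd_one_delta n : cd_one R n = delta_mx 0 (cd0 n).
Proof.
elim: n => [|n IHn]; apply/matrixP => i j.
  by rewrite !mxE !ord1.
rewrite /= IHn -[j]splitK; case: (split j) => l /=.
  by rewrite row_mxEl !mxE !ord1 -!val_eqE.
rewrite row_mxEr !mxE !ord1 -!val_eqE /= addn_eq0.
by rewrite eqn0Ngt cdim_gt0.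
Qed.

(** The conjugation changes the sign of every coordinate but the first one;
    hence [V_n] is a coordinate hyperplane ([cd_imagP]). *)
Lemma cd_conjE n (x : cdalg R n) :
  cd_conj x = (2 * x 0 (cd0 n)) *: cd_one R n - x.
Proof.
elim: n x => [|n IHn] x.
  by apply/matrixP => i j; rewrite !mxE !ord1; ring.
rewrite -[X in _ - X]hsubmxK /= IHn scale_row_mx opp_row_mx add_row_mx.
rewrite scaler0 add0r mxE (_ : lshift _ (cd0 n) = cd0 n.+1) //.
exact: val_inj.
Qed.

Lemma cd_one0 n : cd_one R n 0 (cd0 n) = 1.
Proof. by rewrite cd_one_delta mxE !eqxx. Qed.

Lemma cd_conjK n (x : cdalg R n) : cd_conj (cd_conj x) = x.
Proof.
rewrite !cd_conjE !mxE cd_one0 opprB addrCA -scalerBl.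
by rewrite (_ : _ - _ = 0) ?scale0r ?addr0 //; ring.
Qed.

Lemma cd_imagP n (x : cdalg R n) : cd_imag x <-> x 0 (cd0 n) = 0.
Proof.
rewrite /cd_imag cd_conjE; split=> [|->]; last by rewrite mulr0 scale0r sub0r.
move/matrixP/(_ 0 (cd0 n)); rewrite !mxE cd_one0 mulr1 => /(canRL (addrK _)).
by rewrite opprK addNr => /eqP; rewrite mulf_eq0 pnatr_eq0 => /eqP.
Qed.

Lemma cd_conj0 n : cd_conj 0 = 0 :> cdalg R n.
Proof. by have := cd_conjP (-1) 0 (0 : cdalg R n); rewrite scaler0 scaleN1r addr0 addNr. Qed.

Lemma cd_conjN n (x : cdalg R n) : cd_conj (- x) = - cd_conj x.
Proof. by have := cd_conjP (-1) x 0; rewrite cd_conj0 !addr0 !scaleN1r. Qed.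

Lemma cd_conj1 n : cd_conj (cd_one R n) = cd_one R n.
Proof. by rewrite cd_conjE cd_one0 mulr1 scaler_nat mulr2n addrK. Qed.

Lemma cd_mul0x n (x : cdalg R n) : cd_mul 0 x = 0.
Proof. by have := (cd_mulP (-1) 0 0 x).1; rewrite !scaleN1r !addNr. Qed.

Lemma cd_mulx0 n (x : cdalg R n) : cd_mul x 0 = 0.
Proof. by have := (cd_mulP (-1) 0 0 x).2; rewrite !scaleN1r !addNr. Qed.

Lemma cd_mulNx n (x y : cdalg R n) : cd_mul (- x) y = - cd_mul x y.
Proof. by have := (cd_mulP (-1) x 0 y).1; rewrite cd_mul0x !scaleN1r !addr0. Qed.

Lemma cd_mulxN n (x y : cdalg R n) : cd_mul x (- y) = - cd_mul x y.
Proof. by have := (cd_mulP (-1) y 0 x).2; rewrite cd_mulx0 !scaleN1r !addr0. Qed.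

Lemma cd_mul1 n (x : cdalg R n) :
  cd_mul (cd_one R n) x = x /\ cd_mul x (cd_one R n) = x.
Proof.
elim: n x => [|n IHn] x.
  by split; apply/matrixP => i j; rewrite !mxE !ord1 ?mul1r ?mulr1.
have l u := (IHn u).1; have r u := (IHn u).2.
rewrite /= !row_mxKl !row_mxKr cd_conj0 cd_conj1.
by rewrite !l !r !cd_mulx0 !cd_mul0x !(subr0, addr0, add0r) hsubmxK.
Qed.

(** Polarized norm identity.  The norm form is multiplicative only in low
    dimensions, but this identity needs no associativity: after one doubling,
    the second components cancel and the first ones add up an instance of each
    of the two forms, which is why they are proved together. *)
Lemma cd_mul_polar n (x y : cdalg R n) :
  cd_mul x (cd_conj y) + cd_mul y (cd_conj x) = (2 * dot x y) *: cd_one R n /\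
  cd_mul (cd_conj x) y + cd_mul (cd_conj y) x = (2 * dot x y) *: cd_one R n.
Proof.
elim: n x y => [|n IHn] x y.
  by split; apply/matrixP => i j; rewrite !mxE /dot big_ord1 !ord1; ring.
have l u v := (IHn u v).1; have r u v := (IHn u v).2.
have dotE : dot x y = dot (lsubmx x) (lsubmx y) + dot (rsubmx x) (rsubmx y).
  by rewrite -dot_row !hsubmxK.
rewrite /= !row_mxKl !row_mxKr !cd_conjK !add_row_mx scale_row_mx scaler0.
rewrite !cd_conjN !(cd_mulNx, cd_mulxN) !opprK dotE mulrDr scalerDl.
split; congr row_mx.
- by rewrite -l -r addrACA [cd_mul (cd_conj (rsubmx x)) _ + _]addrC.
- by rewrite addrA addrK addNr.
- by rewrite -!r addrACA [cd_mul (cd_conj (rsubmx y)) _ + _]addrC.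
- by rewrite addrA subrK subrr.
Qed.

Lemma cd_mul_imag n (x y : cdalg R n) : cd_imag x -> cd_imag y ->
  cd_mul x y = cd_cross x y - dot x y *: cd_one R n.
Proof.
move=> imx imy; have [+ _] := cd_mul_polar x y.
rewrite imx imy !cd_mulxN -opprD /cd_cross => /matrixP polar.
apply/matrixP => i j; move/(_ i j): polar; rewrite !mxE => polar.
have -> : dot x y * cd_one R n i j = 2^-1 * (2 * dot x y * cd_one R n i j) by field.
by rewrite -polar; field.
Qed.

Lemma cd_mul_scalar_l n a (x y : cdalg R n) :
  cd_mul (a *: cd_one R n + x) y = a *: y + cd_mul x y.
Proof. by rewrite (cd_mulP _ _ _ _).1 (cd_mul1 _).1. Qed.

Lemma cd_mul_scalar_r n a (x y : cdalg R n) :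
  cd_mul x (a *: cd_one R n + y) = a *: x + cd_mul x y.
Proof. by rewrite (cd_mulP _ _ _ _).2 (cd_mul1 _).2. Qed.

Lemma cd_conj_scalar n a (x : cdalg R n) : cd_imag x ->
  cd_conj (a *: cd_one R n + x) = a *: cd_one R n - x.
Proof. by move=> imx; rewrite cd_conjP cd_conj1 imx. Qed.

(** The cross terms [t u] and [s v] of the product lose their scalar part
    through [cd_mul_imag]; this is where [<s, v> - <t, u>] comes from. *)
Lemma cd_cross_row n (u v s t : cdalg R n) (g d : R) :
  cd_imag u -> cd_imag v -> cd_imag s -> cd_imag t ->
  cd_cross (row_mx u (g *: cd_one R n + s) : cdalg R n.+1)
           (row_mx v (d *: cd_one R n + t)) =
  row_mx (cd_cross u v - cd_cross s t + (g *: t - d *: s))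
         ((dot s v - dot t u) *: cd_one R n + (d *: u - g *: v)
          + (cd_cross t u - cd_cross s v)).
Proof.
move=> imu imv ims imt.
rewrite {1}/cd_cross /= !row_mxKl !row_mxKr !cd_conj_scalar // imu imv.
rewrite !(cd_mul_scalar_l, cd_mul_scalar_r) !(cd_mulNx, cd_mulxN).
rewrite !cd_mul_imag // opp_row_mx add_row_mx scale_row_mx.
rewrite (cd_crossC v u) (cd_crossC t s).
rewrite (_ : dot v u = dot u v); last by apply: eq_bigr => i _; rewrite mulrC.
rewrite (_ : dot t s = dot s t); last by apply: eq_bigr => i _; rewrite mulrC.
by congr row_mx; apply/matrixP => i j; rewrite !mxE; field.
Qed.

End RealTower.

(** * Extension of scalars to the complex numbers *)

Section ComplexTower.
Variable R : realType.

Lemma bil_Re m (x y : 'rV[R[i]]_m) :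
  complex.Re (bil x y) = dot (mxRe x) (mxRe y) - dot (mxIm x) (mxIm y).
Proof.
rewrite /bil raddf_sum /dot -sumrB; apply: eq_bigr => j _.
by rewrite !mxE; case: (x 0 j) (y 0 j) => [a b] [c d].
Qed.

Lemma bil_Im m (x y : 'rV[R[i]]_m) :
  complex.Im (bil x y) = dot (mxRe x) (mxIm y) + dot (mxIm x) (mxRe y).
Proof.
rewrite /bil raddf_sum /dot -big_split; apply: eq_bigr => j _.
by rewrite !mxE; case: (x 0 j) (y 0 j) => [a b] [c d].
Qed.

(** Both sides are complex-bilinear in the two arguments, so the identity is
    inherited from [cd_cross_row]; concretely, its four instances for the real
    and imaginary parts of the arguments are recombined. *)
Lemma cdC_cross_row n (u v s t : cdalg R[i] n) (g d : R[i]) :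
  cdC_imag u -> cdC_imag v -> cdC_imag s -> cdC_imag t ->
  cdC_cross (row_mx u (cdC_scalar n g + s) : cdalg R[i] n.+1)
            (row_mx v (cdC_scalar n d + t)) =
  row_mx (cdC_cross u v - cdC_cross s t + (g *: t - d *: s))
         (cdC_scalar n (bil s v - bil t u) + (d *: u - g *: v)
          + (cdC_cross t u - cdC_cross s v)).
Proof.
move=> [ru iu] [rv iv] [rs is_] [rt it].
have reE (a : R[i]) (x y : cdalg R[i] n) : mxRe (row_mx x (cdC_scalar n a + y)) =
    row_mx (mxRe x) (complex.Re a *: cd_one R n + mxRe y).
  rewrite /mxRe map_row_mx; congr row_mx; apply/matrixP => i j; rewrite !mxE.
  by case: a (y i j) => [a b] [c e] /=; ring.
have imE (a : R[i]) (x y : cdalg R[i] n) : mxIm (row_mx x (cdC_scalar n a + y)) =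
    row_mx (mxIm x) (complex.Im a *: cd_one R n + mxIm y).
  rewrite /mxIm map_row_mx; congr row_mx; apply/matrixP => i j; rewrite !mxE.
  by case: a (y i j) => [a b] [c e] /=; ring.
rewrite {1}/cdC_cross !reE !imE !cd_cross_row // /mxC.
rewrite !(opp_row_mx, add_row_mx) !map_row_mx scale_row_mx add_row_mx.
congr row_mx; apply/matrixP => i j; rewrite !mxE.
  case: g d (s i j) (t i j) => [g g'] [d d'] [s1 s2] [t1 t2] /=.
  apply/eqP; rewrite eq_complex /=.
  by apply/andP; split; apply/eqP; ring.
have := (bil_Re s v, bil_Im s v, bil_Re t u, bil_Im t u).
case: (bil s v) (bil t u) => [sv sv'] [tu tu'] /= [[[-> ->] ->] ->].
case: g d (u i j) (v i j) => [g g'] [d d'] [s1 s2] [t1 t2] /=.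
apply/eqP; rewrite eq_complex /=.
by apply/andP; split; apply/eqP; ring.
Qed.

Lemma iotaC_sqr : iotaC R * iotaC R = -1.
Proof.
apply/eqP; rewrite eq_complex /= !(mul0r, mulr0, mulr1).
by rewrite sub0r addr0 oppr0 !eqxx.
Qed.

(** Taking [c = iota] and [c = - iota] isolates the part even in [c] and the
    part odd in [c]. *)
Lemma cdC_cross_polar n (c : R[i]) (u v s t : cdalg R[i] n) :
  cdC_cross (u + c *: s) (v + c *: t) =
  cdC_cross u v + c *: (cdC_cross u t + cdC_cross s v) + (c * c) *: cdC_cross s t.
Proof.
rewrite addrC [v + _]addrC cdC_crossPl !cdC_crossPr -scalerA.
(* The products become opaque vectors, so that [mxE] does not unfold them. *)
move: (cdC_cross u v) (cdC_cross s t) (cdC_cross u t) (cdC_cross s v) => A B C D.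
by apply/matrixP => i j; rewrite !mxE; ring.
Qed.

Lemma cdC_cross_two_calls n (u v s t : cdalg R[i] n) (g d : R[i]) :
  cdC_imag u -> cdC_imag v -> cdC_imag s -> cdC_imag t ->
  let Zp := cdC_cross (u + iotaC R *: s) (v + iotaC R *: t) in
  let Zm := cdC_cross (u - iotaC R *: s) (v - iotaC R *: t) in
  cdC_cross (row_mx u (cdC_scalar n g + s) : cdalg R[i] n.+1)
            (row_mx v (cdC_scalar n d + t)) =
    row_mx (2^-1 *: (Zp + Zm) + g *: t - d *: s)
           (cdC_scalar n (bil s v - bil t u) + d *: u - g *: v
            + (iotaC R / 2) *: (Zp - Zm)).
Proof.
move=> imu imv ims imt; rewrite cdC_cross_row // -!scaleNr !cdC_cross_polar.
rewrite mulrNN iotaC_sqr (cdC_crossC t u) /=.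
have := iotaC_sqr; move: (iotaC R) => c cc.
move: (cdC_cross u v) (cdC_cross s t) (cdC_cross u t) (cdC_cross s v) => A B C D.
congr row_mx; first by apply/matrixP => i j; rewrite !mxE; field.
apply/matrixP => i j; rewrite !mxE.
(* The half difference of the two products is [c *: (C + D)]. *)
rewrite (_ : c / 2 * _ = c * c * (C i j + D i j)); first by rewrite cc; ring.
by field.
Qed.

Lemma mxC_one n : mxC (cd_one R n) = delta_mx 0 (cd0 n).
Proof. by rewrite cd_one_delta /mxC map_delta_mx. Qed.

Lemma cdC_imagP n (z : cdalg R[i] n) : cdC_imag z <-> z 0 (cd0 n) = 0.
Proof.
rewrite /cdC_imag !cd_imagP !mxE; case: (z 0 _) => a b /=.
by split=> [[-> ->]|[-> ->]].
Qed.

Lemma cdC_imagD n (c : R[i]) (x y : cdalg R[i] n) :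
  cdC_imag x -> cdC_imag y -> cdC_imag (x + c *: y).
Proof.
by move=> /cdC_imagP x0 /cdC_imagP y0; apply/cdC_imagP; rewrite !mxE x0 y0 mulr0 addr0.
Qed.

(** The decomposition [X = (u, gamma + s)] of an imaginary element: [gamma] is
    the first coordinate of the second half of [X]. *)
Lemma cdC_imag_split n (X : cdalg R[i] n.+1) : cdC_imag X ->
  cdC_imag (lsubmx X : cdalg R[i] n) /\
  cdC_imag (rsubmx X - cdC_scalar n ((rsubmx X : cdalg R[i] n) 0 (cd0 n))).
Proof.
move=> /cdC_imagP X0; split; apply/cdC_imagP; rewrite !mxE.
  by rewrite -X0; congr (X _ _); apply: val_inj.
by rewrite cd_one0 mulr1 subrr.
Qed.

End ComplexTower.

(** * Vector programs *)

Section VectorMachine.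
Variables (K : pzRingType) (k : nat) (o : 'I_k).
Variable f : 'rV[K]_k -> 'rV[K]_k -> 'rV[K]_k.

(** Instructions on registers [0, 1, ...] holding vectors of length [k].  A
    scalar is kept in the coordinate [o] of a vector: [VScale d c a] scales [a]
    by the scalar of [c], and [VSum d a] adds the sum of the entries of [a] to
    the scalar of [d].  [VMul] multiplies entrywise, so that [VMul] and [VSum]
    compute a coefficient pairing. *)
Inductive vinstr :=
| VConst (d : nat) (c : 'rV[K]_k)
| VAdd (d a b : nat)
| VSub (d a b : nat)
| VMul (d a b : nat)
| VScale (d c a : nat)
| VSum (d a : nat)
| VCall (d a b : nat).

Definition is_vcall (i : vinstr) : bool :=
  if i is VCall _ _ _ then true else false.

(** A loop overwrites its destination entry by entry, so its operands must be
    other vectors; a call reads both arguments before it writes. *)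
Definition vwf (i : vinstr) : bool :=
  match i with
  | VConst _ _ | VCall _ _ _ => true
  | VAdd d a b | VSub d a b | VMul d a b | VScale d a b => (a != d) && (b != d)
  | VSum d a => a != d
  end.

(* [eqn] rather than [==] lets a concrete program be evaluated by unfolding
   a fixed list of constants. *)
Definition upd (s : nat -> 'rV[K]_k) (d : nat) (v : 'rV[K]_k) : nat -> 'rV[K]_k :=
  fun e => if eqn e d then v else s e.

Lemma updE s d v e : upd s d v e = if e == d then v else s e.
Proof. by []. Qed.

Definition vstep (s : nat -> 'rV[K]_k) (i : vinstr) : nat -> 'rV[K]_k :=
  match i with
  | VConst d c => upd s d c
  | VAdd d a b => upd s d (s a + s b)
  | VSub d a b => upd s d (s a - s b)
  | VMul d a b => upd s d (map2_mx *%R (s a) (s b))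
  | VScale d c a => upd s d (s c 0 o *: s a)
  | VSum d a => upd s d (s d + (\sum_j s a 0 j) *: delta_mx 0 o)
  | VCall d a b => upd s d (f (s a) (s b))
  end.

Definition loop (I : 'I_k -> instr K) : seq (instr K) := [seq I j | j <- enum 'I_k].

Definition compile (i : vinstr) : seq (instr K) :=
  match i with
  | VConst d c => loop (fun j => IConst (d * k + j) (c 0 j))
  | VAdd d a b => loop (fun j => IAdd K (d * k + j) (a * k + j) (b * k + j))
  | VSub d a b => loop (fun j => ISub K (d * k + j) (a * k + j) (b * k + j))
  | VMul d a b => loop (fun j => IMul K (d * k + j) (a * k + j) (b * k + j))
  | VScale d c a => loop (fun j => IMul K (d * k + j) (c * k + o) (a * k + j))
  | VSum d a => loop (fun j => IAdd K (d * k + o) (d * k + o) (a * k + j))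
  | VCall d a b => [:: ICall K (d * k) (a * k) (b * k)]
  end.

Definition compile_prog (p : seq vinstr) : seq (instr K) := flatten (map compile p).

Definition block (mem : nat -> K) (i : nat) : 'rV[K]_k := read_block k mem (i * k).

Lemma blockE mem i (j : 'I_k) : mem (i * k + j)%N = block mem i 0 j.
Proof. by rewrite mxE. Qed.

Lemma block_addr_inj i i' (j j' : 'I_k) :
  (i * k + j == i' * k + j')%N = (i == i') && (j == j').
Proof.
have k0 : (0 < k)%N := leq_ltn_trans (leq0n o) (ltn_ord o).
apply/eqP/andP => [e|[/eqP-> /eqP->] //].
have := congr1 (divn^~ k) e; have := congr1 (modn^~ k) e.
rewrite !modnMDl !divnMDl // !divn_small // !modn_small // !addn0 => ej ->.
by split; apply/eqP => //; apply: val_inj.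
Qed.

Lemma read_write_block N mem d (v : 'rV[K]_N) :
  read_block N (write_block mem d v) d = v.
Proof.
apply/matrixP => i j; rewrite !mxE /write_block leq_addr addKn valK.
by rewrite ord1.
Qed.

Lemma read_block_row p q (mem : nat -> K) a :
  read_block (p + q) mem a =
  row_mx (read_block p mem a) (read_block q mem (a + p)).
Proof.
apply/matrixP => i j; rewrite !mxE.
by case: split_ordP => l ->; rewrite mxE //= addnA.
Qed.

Lemma block_write mem d (j : 'I_k) c :
  block (write mem (d * k + j) c) =1
  upd (block mem) d (\row_l if l == j then c else block mem d 0 l).
Proof.
move=> i; apply/matrixP => z l; rewrite !ord1 -blockE /write block_addr_inj !updE.
by case: eqP => [->|_]; rewrite ?mxE //= -?blockE //; case: ifP.
Qed.

Lemma block_write_block mem d (v : 'rV[K]_k) :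
  block (write_block mem (d * k) v) =1 upd (block mem) d v.
Proof.
move=> i; rewrite updE; case: eqP => [->|/eqP ne]; first exact: read_write_block.
apply/matrixP => z j; rewrite !mxE /write_block; case: leqP => // le.
case: insubP => // l _ ll; move: ne.
have /eqP : (i * k + j = d * k + l)%N by rewrite ll subnKC.
by rewrite block_addr_inj => /andP[->].
Qed.

Lemma run_cat p q mem : run f (p ++ q) mem = run f q (run f p mem).
Proof. exact: foldl_cat. Qed.

(** The hypothesis on a single step concerns every memory that agrees with the
    initial one outside of the destination block: these are the memories met in
    the course of the loop. *)
Lemma block_loop (I : 'I_k -> instr K) d (v : 'rV[K]_k) mem :
  (forall mem' j, (forall i, i != d -> block mem' i = block mem i) ->
     step f mem' (I j) = write mem' (d * k + j) (v 0 j)) ->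
  block (run f (loop I) mem) =1 upd (block mem) d v.
Proof.
move=> stepI.
have inv l : (forall i, i != d -> block (run f (map I l) mem) i = block mem i) /\
    {in l, forall j, block (run f (map I l) mem) d 0 j = v 0 j}.
  elim/last_ind: l => [|l j [IHd IHl]]; first by split.
  rewrite map_rcons -cats1 run_cat /= stepI //; split=> [i ne|j'].
    by rewrite block_write updE (negPf ne) IHd.
  rewrite mem_rcons inE block_write updE eqxx mxE.
  by case: eqP => [-> //|_] /= /IHl.
move=> i; have [ne vE] := inv (enum 'I_k); rewrite updE.
case: eqP => [->|/eqP]; last exact: ne.
by apply/matrixP => z j; rewrite !ord1 vE ?mem_enum.
Qed.

Lemma block_sum d a mem : a != d ->
  block (run f (compile (VSum d a)) mem) =1
  upd (block mem) d (block mem d + (\sum_j block mem a 0 j) *: delta_mx 0 o).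
Proof.
move=> ad; rewrite /= /loop -big_enum /=; elim/last_ind: (enum _) => [|l j IHl].
  by move=> i; rewrite big_nil scale0r addr0 updE; case: eqP => [->|].
rewrite map_rcons -cats1 run_cat => i /=.
rewrite block_write !blockE !updE; case: (i =P d) => [ei|ne]; last first.
  by rewrite IHl updE; case: eqP ne.
apply/matrixP => z q; rewrite !ord1 mxE !IHl !updE eqxx (negPf ad).
rewrite -cats1 big_cat big_seq1 /= !mxE !eqxx /=; case: eqP => [->|_].
  by rewrite !mulr1 addrA.
by rewrite !mulr0.
Qed.

Lemma compile_correct i mem : vwf i ->
  block (run f (compile i) mem) =1 vstep (block mem) i.
Proof.
case: i => [d c|d a b|d a b|d a b|d c a|d a|d a b] /= wf; try case/andP: wf => wfa wfb.
- exact: block_loop.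
- by apply: block_loop => mem' j E /=; rewrite !blockE !E // !mxE.
- by apply: block_loop => mem' j E /=; rewrite !blockE !E // !mxE.
- by apply: block_loop => mem' j E /=; rewrite !blockE !E // !mxE.
- by apply: block_loop => mem' j E /=; rewrite !blockE !E // !mxE.
- exact: block_sum.
- exact: block_write_block.
Qed.

Lemma vstep_ext s s' i : s =1 s' -> vstep s i =1 vstep s' i.
Proof. by move=> E; case: i => * e /=; rewrite !updE ?E. Qed.

Lemma compile_prog_correct p mem : all vwf p ->
  block (run f (compile_prog p) mem) =1 foldl vstep (block mem) p.
Proof.
have ext q s s' : s =1 s' -> foldl vstep s q =1 foldl vstep s' q.
  by elim: q s s' => //= i q IH s s' E; apply: IH; apply: vstep_ext.
elim: p mem => //= i p IH mem /andP[wi wp] e; rewrite /compile_prog /= run_cat IH //.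
by apply: ext; apply: compile_correct.
Qed.

Lemma calls_compile p : calls (compile_prog p) = count is_vcall p.
Proof.
rewrite /calls; elim: p => //= i p IH.
rewrite /compile_prog /= count_cat -/(compile_prog p) IH; congr addn.
by case: i => *; rewrite //= /loop count_map; exact: count_pred0.
Qed.

Lemma arith_ops_compile p : (arith_ops (compile_prog p) <= size p * k)%N.
Proof.
rewrite /arith_ops; elim: p => //= i p IH.
rewrite /compile_prog /= count_cat mulSn leq_add //.
by case: i => *; rewrite //= /loop (leq_trans (count_size _ _)) // size_map size_enum_ord.
Qed.

End VectorMachine.

(** * The program for the cross product *)

Arguments VAdd {K k}.
Arguments VSub {K k}.
Arguments VMul {K k}.
Arguments VScale {K k}.
Arguments VSum {K k}.
Arguments VCall {K k}.

Section Program.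
Variables (R : realType) (n : nat).

Local Notation k := (cdim n).

(** The inputs [X = (u, gamma + s)] and [Y = (v, delta + t)] are found in the
    registers 0 to 3, and the two halves of the result are left in 33 and 34. *)
Definition cross_prog : seq (vinstr R[i] k) :=
  [:: VConst 4 (delta_mx 0 (cd0 n));
      VConst 5 (const_mx (iotaC R));
      VConst 6 (const_mx 2^-1);
      VConst 7 (const_mx (iotaC R / 2));
      (* 9 and 11: [s] and [t] *)
      VScale 8 1 4; VSub 9 1 8; VScale 10 3 4; VSub 11 3 10;
      (* 14 to 17: [u + iota s], [v + iota t], [u - iota s], [v - iota t] *)
      VScale 12 5 9; VScale 13 5 11;
      VAdd 14 0 12; VAdd 15 2 13; VSub 16 0 12; VSub 17 2 13;
      (* 18 and 19: [Z+] and [Z-] *)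
      VCall 18 14 15; VCall 19 16 17;
      (* 23 and 24: the two terms of the first half *)
      VAdd 20 18 19; VScale 21 6 20; VScale 22 1 11; VAdd 23 21 22;
      VScale 24 3 9;
      (* 26 and 29: [iota / 2 (Z+ - Z-)] and [delta u - gamma v] *)
      VSub 25 18 19; VScale 26 7 25;
      VScale 27 3 0; VScale 28 1 2; VSub 29 27 28;
      (* 32: a vector whose entries sum to [lambda] *)
      VMul 30 9 2; VMul 31 11 0; VSub 32 30 31;
      VSub 33 23 24;
      VAdd 34 29 26; VSum 34 32].

Lemma cross_prog_correct :
  evaluates_cross n (compile_prog (cd0 n) cross_prog) (33 * k).
Proof.
move=> f fE X Y imX imY.
have [imu ims] := cdC_imag_split imX; have [imv imt] := cdC_imag_split imY.
set u : cdalg R[i] n := lsubmx X in imu; set v : cdalg R[i] n := lsubmx Y in imv.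
set w : cdalg R[i] n := rsubmx X in ims; set z : cdalg R[i] n := rsubmx Y in imt.
set g := w 0 (cd0 n) in ims; set d := z 0 (cd0 n) in imt.
set s := w - _ in ims; set t := z - _ in imt.
have XE : X = row_mx u (cdC_scalar n g + s) by rewrite addrC subrK hsubmxK.
have YE : Y = row_mx v (cdC_scalar n d + t) by rewrite addrC subrK hsubmxK.
rewrite [in RHS]XE [in RHS]YE cdC_cross_two_calls //.
rewrite /run2; set mem := write_block _ _ _.
have [[m0 m1] [m2 m3]] : (block k mem 0 = u /\ block k mem 1 = w) /\
                         (block k mem 2 = v /\ block k mem 3 = z).
  have := read_write_block (fun=> 0) 0 (row_mx X Y).
  rewrite -/mem read_block_row => /eq_row_mx[].
  rewrite -[X in _ = X -> _]hsubmxK -[X in _ -> _ = X -> _]hsubmxK.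
  rewrite !read_block_row add0n => /eq_row_mx[? ?] /eq_row_mx[? ?].
  by rewrite /block !mulSn !mul0n ?addn0 addnA.
rewrite [LHS](read_block_row k k).
have blk i := compile_prog_correct (cd0 n) f mem (isT : all (@vwf _ k) cross_prog) i.
rewrite -/(block k _ 33) addnC -mulSn -/(block k _ 34) !blk {blk}.
move: (block k mem) m0 m1 m2 m3 => S0 m0 m1 m2 m3.
(* Only the interpreter is unfolded, eagerly: every intermediate vector is
   then computed once, where simplification would duplicate it. *)
cbv beta iota delta [foldl cross_prog vstep upd eqn].
have const0 (c : R[i]) : const_mx c 0 (cd0 n) = c :> R[i] by rewrite mxE.
have scalE a : cdC_scalar n a = a *: delta_mx 0 (cd0 n) by rewrite -mxC_one.
rewrite m0 m1 m2 m3 !const0 -/g -/d -!scalE -/s -/t.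
clearbody s t g d u v.
rewrite -!(scaleNr (iotaC R)) !fE; [|exact: cdC_imagD..].
rewrite (_ : \sum_j _ = bil s v - bil t u).
  by congr row_mx; rewrite addrC !addrA.
by rewrite /bil -sumrB; apply: eq_bigr => j _; rewrite !mxE.
Qed.

End Program.

Theorem theorem3p3 (R : realType) :
  (forall n : nat, (2 <= n.+1)%N ->
   forall (u v s t : cdalg R[i] n) (gamma delta : R[i]),
     cdC_imag u -> cdC_imag v -> cdC_imag s -> cdC_imag t ->
     let X : cdalg R[i] n.+1 := row_mx u (cdC_scalar n gamma + s) in
     let Y : cdalg R[i] n.+1 := row_mx v (cdC_scalar n delta + t) in
     let Zp := cdC_cross (u + iotaC R *: s) (v + iotaC R *: t) in
     let Zm := cdC_cross (u - iotaC R *: s) (v - iotaC R *: t) in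
     let lambda := bil s v - bil t u in
     cdC_cross X Y =
       row_mx (2^-1 *: (Zp + Zm) + gamma *: t - delta *: s)
              (cdC_scalar n lambda + delta *: u - gamma *: v
               + (iotaC R / 2) *: (Zp - Zm)))
  /\
  (exists K : nat, forall n : nat, (2 <= n.+1)%N ->
   exists (p : seq (instr R[i])) (out : nat),
     [/\ evaluates_cross n p out,
         calls p = 2%N &
         (arith_ops p <= K * 2 ^ n.+1)%N]).
Proof.
split=> [n _ u v s t g d imu imv ims imt X Y Zp Zm lambda|].
  exact: cdC_cross_two_calls.
(* 32 instructions on blocks of length [2 ^ n] *)
exists 16%N => n _; exists (compile_prog (cd0 n) (cross_prog R n)), (33 * cdim n)%N.
split; first exact: cross_prog_correct.
  by rewrite calls_compile.
apply: leq_trans (arith_ops_compile _ _) _.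
by rewrite expnS mulnA -cdimE.
Qed.
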